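(* Let $X,Y\in\mathcal M_{p,n}$ be two random matrices such that $(X,Y)\propto\mathcal E_2$ and $\|\mathbb E[X]\|_F,\|\mathbb E[Y]\|_F\le O(1)$ (as $n,p\to\infty$). Then for any deterministic matrix $A\in\mathcal M_p$ we have the linear concentration, in $(\mathcal M_n,\|\cdot\|_F)$, $$Y^TAX\in\mathcal E_2(\|A\|_F)+\mathcal E_1(\|A\|).$$
   Context: $\mathcal M_{p,n}$ is the set of real $p\times n$ matrices, $\mathcal M_p=\mathcal M_{p,p}$; $\|\cdot\|$ is the spectral norm and $\|\cdot\|_F$ the Frobenius norm. All objects are sequences indexed by the dimensions $(p,n)$; $a\le O(b)$ means $a\le Cb$ for a constant $C>0$ independent of the indices. $(X,Y)\propto\mathcal E_2$ means: there exist constants $C,c>0$ independent of the indices such that for all $1$-Lipschitz $f:\mathcal M_{p,n}\times\mathcal M_{p,n}\to\mathbb R$ (Lipschitz for the product norm built from the Frobenius norms) and all $t>0$, $\mathbb P(|f(X,Y)-\mathbb E[f(X,Y)]|\ge t)\le Ce^{-(t/c)^2}$. Linear concentration: for a (sequence of) random vectors $Z$ in a normed space $(E,\|\cdot\|_E)$, $Z\in\sum_l\mathcal E_{q_l}(\sigma_l)$ means that there exist a (sequence of) deterministic vectors $\tilde Z\in E$ and constants $C,c>0$ such that for all indices, all linear forms $f$ on $E$ with $|f(x)|\le\|x\|_E$ for all $x\in E$, and all $t>0$, $\mathbb P(|f(Z)-f(\tilde Z)|\ge t)\le C\sum_le^{-(t/(c\sigma_l))^{q_l}}$. The constants do not depend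 on $A$. *)

(* Defs.v *)
From HB Require Import structures.
From mathcomp Require Import all_boot all_order all_algebra.
From mathcomp Require Import all_classical all_reals all_analysis.
Set Implicit Arguments.
Unset Strict Implicit.
Unset Printing Implicit Defensive.
Import Order.TTheory GRing.Theory Num.Theory.
Local Open Scope classical_set_scope.
Local Open Scope ring_scope.

Definition frobenius_norm (R : realType) (m n : nat) (A : 'M[R]_(m, n)) : R :=
  Num.sqrt (\sum_(i < m) \sum_(j < n) A i j ^+ 2).

(* On column vectors [frobenius_norm] is the Euclidean norm, so this is the
   operator norm of A from (R^n, l2) to (R^m, l2).  The set is nonempty
   (it contains 0) and bounded, so [sup] is a genuine supremum. *)
Definition spectral_norm (R : realType) (m n : nat) (A : 'M[R]_(m, n)) : R :=
  sup [set frobenius_norm (A *m x) |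
       x in [set x : 'cV[R]_n | frobenius_norm x <= 1]].

(* Entrywise measurability, i.e. measurability for the Borel sigma-algebra of
   the finite-dimensional space 'M[R]_(m, n). *)
Definition random_matrix (R : realType) (d : measure_display)
    (T : measurableType d) (m n : nat) (X : T -> 'M[R]_(m, n)) : Prop :=
  forall i j, measurable_fun setT (fun w => X w i j).

Definition mx_expectation (R : realType) (d : measure_display)
    (T : measurableType d) (P : probability T R) (m n : nat)
    (X : T -> 'M[R]_(m, n)) : 'M[R]_(m, n) :=
  \matrix_(i, j) fine ('E_P[fun w => X w i j])%E.

(* 1-Lipschitz for the norm sqrt(|x|_F^2 + |y|_F^2).  The norm `|_| that the
   library puts on matrices is the max norm, hence no use of [k.-lipschitz]. *)
Definition lipschitz1 (R : realType) (m n : nat)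
    (f : 'M[R]_(m, n) * 'M[R]_(m, n) -> R) : Prop :=
  forall u v, `|f u - f v| <=
    Num.sqrt (frobenius_norm (u.1 - v.1) ^+ 2 + frobenius_norm (u.2 - v.2) ^+ 2).

(* (X, Y) \propto E_2 at one index, with explicit constants C and c; for a
   sequence, C and c have to be the same for all indices.  Integrability says
   that the expectation of f(X, Y) makes sense. *)
Definition lipschitz_conc_E2 (R : realType) (d : measure_display)
    (T : measurableType d) (P : probability T R) (m n : nat)
    (X Y : T -> 'M[R]_(m, n)) (C c : R) : Prop :=
  forall f : 'M[R]_(m, n) * 'M[R]_(m, n) -> R, lipschitz1 f ->
    P.-integrable setT (fun w => (f (X w, Y w))%:E) /\
    forall t : R, 0 < t ->
      (P [set w | (t <= `|f (X w, Y w) - fine 'E_P[fun w' => f (X w', Y w')]|)%R]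
       <= (C * expR (- (t / c) ^+ 2))%:E)%E.

(* exp (- (t / s) ^ q), extended by its limit 0 at s = 0 (for t, q > 0); the
   formula alone would give 1 there because t / 0 = 0. *)
Definition exp_tail (R : realType) (q s t : R) : R :=
  if s == 0 then 0 else expR (- ((t / s) `^ q)).

(* Z \in \sum_l E_{q_l}(sigma_l) in the normed space (E, normE), at one index and
   with explicit constants C and c; [qs] is the list of the pairs
   (q_l, sigma_l). *)
Definition linear_conc (R : realType) (d : measure_display)
    (T : measurableType d) (P : probability T R) (E : lmodType R)
    (normE : E -> R) (Z : T -> E) (qs : seq (R * R)) (C c : R) : Prop :=
  exists Zt : E, forall f : {scalar E}, (forall x : E, `|f x| <= normE x) ->
    forall t : R, 0 < t ->
      (P [set w | (t <= `|f (Z w) - f Zt|)%R]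
       <= (C * \sum_(l <- qs) exp_tail l.1 (c * l.2) t)%:E)%E.

(* Main.v *)
Require Import Defs.
From HB Require Import structures.
From mathcomp Require Import all_boot all_order all_algebra.
From mathcomp Require Import all_classical all_reals all_analysis.
From mathcomp Require Import measurable_realfun ring lra.
Set Implicit Arguments.
Unset Strict Implicit.
Unset Printing Implicit Defensive.
Import Order.TTheory GRing.Theory Num.Theory.
Local Open Scope classical_set_scope.
Local Open Scope ring_scope.

(* A linear form bounded by the Frobenius norm is <B, .> with |B|_F <= 1, so the
   statement concerns the bilinear form g(X, Y) = <B, Y^T A X>, whose gradients
   are A X B^T and A^T Y B.  These are |A|-Lipschitz in X and Y, with mean norm
   O(|A|_F) (the variances of the entries come from integrating the tails), so
   off an event of probability 2C exp(-(r/c)^2) both are at most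
   L_r = O(|A|_F) + r |A|.  There g agrees with a 2 L_r-Lipschitz function
   (McShane extension), which concentrates around its mean m_r.  Two events of
   probability close to 1 intersect, so m_r moves by O(L_r) only when r varies,
   and r = sqrt(t / |A|) gives the two tails around a fixed center m.  Integrating
   these tails gives |E g - m| = O(|A|_F), which allows to take
   E[Y^T A X] as center: unlike m, it does not depend on B. *)

(** * Frobenius inner product, Frobenius norm and spectral norm *)

Definition frobenius_dot (R : realType) (m n : nat) (A B : 'M[R]_(m, n)) : R :=
  \tr (A^T *m B).

Section FrobeniusDot.
Variables (R : realType).
Implicit Types m n k : nat.

Local Notation fdot := frobenius_dot.
Local Notation fnorm := frobenius_norm.

Lemma frobenius_dotE m n (A B : 'M[R]_(m, n)) :
  fdot A B = \sum_i \sum_j A i j * B i j.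
Proof.
rewrite /frobenius_dot /mxtrace exchange_big /=; apply: eq_bigr => j _.
by rewrite mxE; apply: eq_bigr => i _; rewrite mxE.
Qed.

Lemma frobenius_dotC m n (A B : 'M[R]_(m, n)) : fdot A B = fdot B A.
Proof. by rewrite /frobenius_dot -mxtrace_tr trmx_mul trmxK. Qed.

Lemma frobenius_dotDr m n (A B C : 'M[R]_(m, n)) :
  fdot A (B + C) = fdot A B + fdot A C.
Proof. by rewrite /frobenius_dot mulmxDr mxtraceD. Qed.

Lemma frobenius_dotZr m n a (A B : 'M[R]_(m, n)) :
  fdot A (a *: B) = a * fdot A B.
Proof. by rewrite /frobenius_dot -scalemxAr mxtraceZ. Qed.

Lemma frobenius_dotBr m n (A B C : 'M[R]_(m, n)) :
  fdot A (B - C) = fdot A B - fdot A C.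
Proof. by rewrite -scaleN1r frobenius_dotDr frobenius_dotZr mulN1r. Qed.

Lemma frobenius_dotDl m n (A B C : 'M[R]_(m, n)) :
  fdot (A + B) C = fdot A C + fdot B C.
Proof. by rewrite !(frobenius_dotC _ C) frobenius_dotDr. Qed.

Lemma frobenius_dotZl m n a (A B : 'M[R]_(m, n)) :
  fdot (a *: A) B = a * fdot A B.
Proof. by rewrite !(frobenius_dotC _ B) frobenius_dotZr. Qed.

Lemma frobenius_dotBl m n (A B C : 'M[R]_(m, n)) :
  fdot (A - B) C = fdot A C - fdot B C.
Proof. by rewrite !(frobenius_dotC _ C) frobenius_dotBr. Qed.

(** Factors cross the inner product as transposes; this rule and the next produce the gradients of
    the bilinear form. *)
Lemma frobenius_dotMl m n k (A : 'M[R]_(m, k)) (B : 'M[R]_(k, n)) C :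
  fdot (A *m B) C = fdot B (A^T *m C).
Proof. by rewrite /frobenius_dot trmx_mul mulmxA. Qed.

Lemma frobenius_dotMr m n k (A : 'M[R]_(m, k)) (B : 'M[R]_(k, n)) C :
  fdot (A *m B) C = fdot A (C *m B^T).
Proof. by rewrite /frobenius_dot trmx_mul -mulmxA mxtrace_mulC mulmxA. Qed.

Lemma frobenius_dot_delta m n i j (A : 'M[R]_(m, n)) :
  fdot (delta_mx i j) A = A i j.
Proof.
rewrite frobenius_dotE (bigD1 i)//= (bigD1 j)//= !mxE !eqxx mul1r.
rewrite !big1 ?addr0// => [i' /negbTE ii'|j' /negbTE jj'].
  by rewrite big1// => j' _; rewrite mxE ii' mul0r.
by rewrite mxE jj' andbF mul0r.
Qed.

Lemma frobenius_normK m n (A : 'M[R]_(m, n)) : fnorm A ^+ 2 = fdot A A.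
Proof.
rewrite /frobenius_norm sqr_sqrtr; last first.
  by do 2!apply: sumr_ge0 => ? _; exact: sqr_ge0.
by rewrite frobenius_dotE; do 2!apply: eq_bigr => ? _.
Qed.

Lemma frobenius_norm_ge0 m n (A : 'M[R]_(m, n)) : 0 <= fnorm A.
Proof. exact: sqrtr_ge0. Qed.
Hint Resolve frobenius_norm_ge0 : core.

Lemma frobenius_norm_sum m n (A : 'M[R]_(m, n)) :
  fnorm A ^+ 2 = \sum_i \sum_j A i j ^+ 2.
Proof.
by rewrite frobenius_normK frobenius_dotE; do 2!apply: eq_bigr => ? _.
Qed.

Lemma frobenius_norm_entry m n (A : 'M[R]_(m, n)) i j :
  A i j ^+ 2 <= fnorm A ^+ 2.
Proof.
rewrite frobenius_norm_sum (bigD1 i) //= (bigD1 j) //= -addrA lerDl.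
apply: addr_ge0; first by apply: sumr_ge0 => ? _; exact: sqr_ge0.
by do 2!apply: sumr_ge0 => ? _; exact: sqr_ge0.
Qed.

Lemma frobenius_norm0 m n : fnorm (0 : 'M[R]_(m, n)) = 0.
Proof.
apply/eqP; rewrite -sqrf_eq0 frobenius_normK.
by rewrite -(scale0r 0) frobenius_dotZr mul0r.
Qed.

Lemma frobenius_norm0_eq0 m n (A : 'M[R]_(m, n)) : fnorm A = 0 -> A = 0.
Proof.
move=> A0; apply/matrixP => i j; rewrite mxE.
apply/eqP; rewrite -sqrf_eq0 eq_le sqr_ge0 andbT.
by rewrite (le_trans (frobenius_norm_entry A i j))// A0 expr0n.
Qed.

Lemma frobenius_normZ m n a (A : 'M[R]_(m, n)) : fnorm (a *: A) = `|a| * fnorm A.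
Proof.
apply/eqP; rewrite -(@eqrXn2 _ 2) ?mulr_ge0// exprMn !frobenius_normK.
by rewrite frobenius_dotZl frobenius_dotZr mulrA real_normK ?num_real.
Qed.

Lemma frobenius_normN m n (A : 'M[R]_(m, n)) : fnorm (- A) = fnorm A.
Proof. by rewrite -scaleN1r frobenius_normZ normrN1 mul1r. Qed.

Lemma frobenius_norm_tr m n (A : 'M[R]_(m, n)) : fnorm A^T = fnorm A.
Proof.
apply/eqP; rewrite -(@eqrXn2 _ 2)// !frobenius_normK.
by rewrite /frobenius_dot trmxK mxtrace_mulC.
Qed.

(** Cauchy-Schwarz: the squared norm of [fnorm B *: A - fnorm A *: B] is
    [2 |A| |B| (|A| |B| - <A, B>)]. Zero norms are split off because [|A| |B|] gets cancelled. *)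
Lemma frobenius_dot_le m n (A B : 'M[R]_(m, n)) :
  fdot A B <= fnorm A * fnorm B.
Proof.
have [/eqP /frobenius_norm0_eq0 ->|A0] := boolP (fnorm A == 0).
  by rewrite frobenius_norm0 mul0r -(scale0r 0) frobenius_dotZl mul0r.
have [/eqP /frobenius_norm0_eq0 ->|B0] := boolP (fnorm B == 0).
  by rewrite frobenius_norm0 mulr0 -(scale0r 0) frobenius_dotZr mul0r.
have AB : 0 < fnorm A * fnorm B by rewrite mulr_gt0// lt_def ?A0 ?B0/=.
have := sqr_ge0 (fnorm (fnorm B *: A - fnorm A *: B)).
rewrite frobenius_normK frobenius_dotBl !frobenius_dotBr.
rewrite !frobenius_dotZl !frobenius_dotZr -!frobenius_normK (frobenius_dotC B A).
have -> : fnorm B * (fnorm B * fnorm A ^+ 2) - fnorm B * (fnorm A * fdot A B) -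
  (fnorm A * (fnorm B * fdot A B) - fnorm A * (fnorm A * fnorm B ^+ 2))
  = 2 * (fnorm A * fnorm B) * (fnorm A * fnorm B - fdot A B) by ring.
by rewrite pmulr_rge0 ?subr_ge0// mulr_gt0.
Qed.

Lemma frobenius_dot_norm m n (A B : 'M[R]_(m, n)) :
  `|fdot A B| <= fnorm A * fnorm B.
Proof.
rewrite ler_norml frobenius_dot_le andbT lerNl -mulN1r -frobenius_dotZl.
by rewrite (le_trans (frobenius_dot_le _ _))// scaleN1r frobenius_normN.
Qed.

Lemma frobenius_normD m n (A B : 'M[R]_(m, n)) :
  fnorm (A + B) <= fnorm A + fnorm B.
Proof.
rewrite -(@ler_pXn2r _ 2) ?nnegrE ?addr_ge0// sqrrD !frobenius_normK.
rewrite frobenius_dotDl !frobenius_dotDr (frobenius_dotC B A).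
by have := frobenius_dot_le A B; lra.
Qed.

Lemma frobenius_distC m n (A B : 'M[R]_(m, n)) : fnorm (A - B) = fnorm (B - A).
Proof. by rewrite -frobenius_normN opprB. Qed.

Lemma frobenius_dist_dist m n (A B : 'M[R]_(m, n)) :
  `|fnorm A - fnorm B| <= fnorm (A - B).
Proof.
rewrite ler_distl; apply/andP; split.
  by rewrite lerBlDr frobenius_distC (le_trans _ (frobenius_normD _ _))// subrKC.
by rewrite (le_trans _ (frobenius_normD _ _))// subrKC.
Qed.

Lemma frobenius_norm_row m n (A : 'M[R]_(m, n)) :
  fnorm A ^+ 2 = \sum_i fnorm (row i A) ^+ 2.
Proof.
rewrite frobenius_norm_sum; apply: eq_bigr => i _.
rewrite frobenius_norm_sum big_ord1.
by apply: eq_bigr => j _; rewrite mxE.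
Qed.

Lemma frobenius_norm_col m n (A : 'M[R]_(m, n)) :
  fnorm A ^+ 2 = \sum_j fnorm (col j A) ^+ 2.
Proof.
rewrite -frobenius_norm_tr frobenius_norm_row; apply: eq_bigr => j _.
by rewrite -tr_col frobenius_norm_tr.
Qed.

Lemma mulmx_entry_dot m n k (A : 'M[R]_(m, k)) (B : 'M[R]_(k, n)) i j :
  (A *m B) i j = fdot (row i A)^T (col j B).
Proof.
rewrite frobenius_dotE mxE; apply: eq_bigr => l _.
by rewrite big_ord1 !mxE.
Qed.

(** Each entry of the product is a row-column inner product; Cauchy-Schwarz bounds its square by a
    product that factors when summed over [i] and [j]. *)
Lemma frobenius_normM m n k (A : 'M[R]_(m, k)) (B : 'M[R]_(k, n)) :
  fnorm (A *m B) <= fnorm A * fnorm B.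
Proof.
rewrite -(@ler_pXn2r _ 2) ?nnegrE ?mulr_ge0// exprMn.
rewrite frobenius_norm_sum frobenius_norm_row frobenius_norm_col mulr_suml.
apply: ler_sum => i _; rewrite mulr_sumr; apply: ler_sum => j _.
rewrite mulmx_entry_dot -exprMn -(frobenius_norm_tr (row i A)).
rewrite -[leLHS]real_normK ?num_real// ler_pXn2r ?nnegrE ?mulr_ge0//.
exact: frobenius_dot_norm.
Qed.

Lemma frobenius_norm_col_mx m n k (A : 'M[R]_(m, n)) (B : 'M[R]_(k, n)) :
  fnorm (col_mx A B) = Num.sqrt (fnorm A ^+ 2 + fnorm B ^+ 2).
Proof.
rewrite -[LHS]ger0_norm// -sqrtr_sqr.
congr Num.sqrt; rewrite !frobenius_norm_row big_split_ord/=.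
by congr (_ + _); apply: eq_bigr => i _; rewrite ?rowKu ?rowKd.
Qed.

Lemma spectral_norm_has_sup m n (A : 'M[R]_(m, n)) :
  has_sup [set fnorm (A *m x) | x in [set x : 'cV[R]_n | fnorm x <= 1]].
Proof.
split; first by exists 0, 0; rewrite /= ?mulmx0 ?frobenius_norm0.
exists (fnorm A) => _ [x /= x1 <-].
by rewrite (le_trans (frobenius_normM _ _))// ler_piMr.
Qed.

Lemma spectral_norm_ge0 m n (A : 'M[R]_(m, n)) : 0 <= spectral_norm A.
Proof.
apply: sup_upper_bound; first exact: spectral_norm_has_sup.
by exists 0; rewrite /= ?mulmx0 frobenius_norm0.
Qed.
Hint Resolve spectral_norm_ge0 : core.

Lemma spectral_norm_le_frobenius m n (A : 'M[R]_(m, n)) :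
  spectral_norm A <= fnorm A.
Proof.
apply: ge_sup; first by case: (spectral_norm_has_sup A).
move=> _ [x /= x1 <-].
by rewrite (le_trans (frobenius_normM _ _))// ler_piMr.
Qed.

(** Vectors first, by normalization; then column by column, since the squared Frobenius norm is the
    sum of the squared norms of the columns. *)
Lemma spectral_norm_mulmx m n k (A : 'M[R]_(m, n)) (B : 'M[R]_(n, k)) :
  fnorm (A *m B) <= spectral_norm A * fnorm B.
Proof.
have colbound (x : 'cV[R]_n) : fnorm (A *m x) <= spectral_norm A * fnorm x.
  have [/eqP /frobenius_norm0_eq0 ->|x0] := boolP (fnorm x == 0).
    by rewrite mulmx0 !frobenius_norm0 mulr0.
  have xgt0 : 0 < fnorm x by rewrite lt_def x0/=.
  rewrite -ler_pdivrMr// mulrC.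
  rewrite -[X in X * _]ger0_norm ?invr_ge0// -frobenius_normZ scalemxAr.
  apply: sup_upper_bound; first exact: spectral_norm_has_sup.
  exists ((fnorm x)^-1 *: x) => //=.
  by rewrite frobenius_normZ ger0_norm ?invr_ge0// mulVf.
rewrite -(@ler_pXn2r _ 2) ?nnegrE ?mulr_ge0// exprMn.
rewrite !frobenius_norm_col mulr_sumr; apply: ler_sum => j _.
by rewrite colE -mulmxA -colE -exprMn ler_pXn2r ?nnegrE ?mulr_ge0.
Qed.

(** [|A^T B|_F^2 = <B, A A^T B> <= |B|_F |A| |A^T B|_F], and one factor [|A^T B|_F] cancels. *)
Lemma spectral_norm_trmulmx m n k (A : 'M[R]_(m, n)) (B : 'M[R]_(m, k)) :
  fnorm (A^T *m B) <= spectral_norm A * fnorm B.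
Proof.
have [/eqP ->|AB0] := boolP (fnorm (A^T *m B) == 0); first by rewrite mulr_ge0.
have ABgt0 : 0 < fnorm (A^T *m B) by rewrite lt_def AB0/=.
rewrite -(ler_pM2r ABgt0) -expr2 frobenius_normK frobenius_dotMl trmxK.
rewrite (le_trans (frobenius_dot_le _ _))// mulrAC [leLHS]mulrC.
by rewrite ler_wpM2r// spectral_norm_mulmx.
Qed.

Lemma spectral_norm_eq0 m n (A : 'M[R]_(m, n)) : spectral_norm A = 0 -> A = 0.
Proof.
move=> A0; apply: frobenius_norm0_eq0; apply/eqP; rewrite eq_le.
have := spectral_norm_mulmx A 1%:M; rewrite mulmx1 A0 mul0r => ->.
exact: frobenius_norm_ge0.
Qed.

(** Riesz representation: the entries of [B] are the values of [f] on the matrix units, and testing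
    [f] on [B] itself gives [|B|_F^2 = f B <= |B|_F]. *)
Lemma scalar_frobenius_dot m n (f : {scalar 'M[R]_(m, n)}) :
  (forall M, `|f M| <= fnorm M) ->
  exists2 B, fnorm B <= 1 & forall M, f M = fdot B M.
Proof.
move=> f1; pose B := \matrix_(i, j) f (delta_mx i j).
have fB M : f M = fdot B M.
  rewrite {1}(matrix_sum_delta M) raddf_sum frobenius_dotE.
  apply: eq_bigr => i _; rewrite raddf_sum; apply: eq_bigr => j _.
  by rewrite mxE mulrC; exact: (scalarZ f).
exists B => //; have [/eqP ->|B0] := boolP (fnorm B == 0); first exact: ler01.
have Bgt0 : 0 < fnorm B by rewrite lt_def B0/=.
rewrite -(ler_pM2r Bgt0) mul1r -expr2 frobenius_normK -fB.
exact: le_trans (ler_norm _) (f1 B).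
Qed.

End FrobeniusDot.
#[export] Hint Extern 0 (is_true (0 <= frobenius_norm _)) =>
  solve [exact: frobenius_norm_ge0] : core.
#[export] Hint Extern 0 (is_true (0 <= spectral_norm _)) =>
  solve [exact: spectral_norm_ge0] : core.

(** * Tail probabilities and expectations *)

Section Probability.
Context d (T : measurableType d) (R : realType) (P : probability T R).

Lemma measurable_set_ge (h : T -> R) t : measurable_fun setT h ->
  measurable [set w | t <= h w].
Proof.
move=> mh; have := mh measurableT _ (measurable_itv `[t, +oo[).
rewrite setTI (_ : _ @^-1` _ = [set w | t <= h w])//.
by apply/seteqP; split => w /=; rewrite in_itv/= andbT.
Qed.

Lemma le_probability (A B : set T) (b : \bar R) :
  measurable A -> measurable B -> A `<=` B -> (P B <= b)%E -> (P A <= b)%E.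
Proof. by move=> mA mB AB; apply: le_trans; apply: le_measure; rewrite ?inE. Qed.

Lemma probability_union_bound (A B C : set T) (b c : R) :
  measurable A -> measurable B -> measurable C -> A `<=` B `|` C ->
  (P B <= b%:E)%E -> (P C <= c%:E)%E -> (P A <= (b + c)%:E)%E.
Proof.
move=> mA mB mC ABC Bb Cc; apply: (le_probability mA _ ABC).
  exact: measurableU.
by rewrite (le_trans (measureU2 _ _ _))// EFinD leeD.
Qed.

(** Source of sample points: one outside a bad event, or one outside two bad events whose union has
    probability below 1. *)
Lemma exists_notin_of_probability_lt1 (A : set T) (a : R) : measurable A ->
  (P A <= a%:E)%E -> a < 1 -> exists w, ~ A w.
Proof.
move=> mA Aa a1; apply: contrapT => /forallNP nA.
have AT : A = setT by apply/seteqP; split => // w _; apply: contrapT; exact: nA.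
by move: Aa; rewrite AT probability_setT lee_fin leNgt a1.
Qed.

(** Layer-cake formula: the expectation is the integral of [P (h > r)] over [r >= 0], and the tail
    bound is [C * s] times the density of the exponential law of rate [s^-1], of total mass 1. *)
Lemma expectation_exponential_tail (h : T -> R) (C s : R) :
  measurable_fun setT h -> (forall w, 0 <= h w) -> 1 <= C -> 0 < s ->
  (forall t : R, 0 < t ->
    (P [set w | (t <= h w)%R] <= (C * expR (- (t / s)))%:E)%E) ->
  (\int[P]_w (h w)%:E <= (C * s)%:E)%E.
Proof.
move=> mh h0 C1 s0 tail.
have C0 : 0 <= C by rewrite (le_trans _ C1).
pose hX : {mfun T >-> R} := HB.pack h (isMeasurableFun.Build _ _ _ _ h mh).
have -> : (\int[P]_w (h w)%:E = 'E_P[hX])%E by rewrite unlock.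
rewrite (@ge0_expectation_ccdf _ _ _ P hX)//.
have mpdf := @measurable_exponential_pdf R s^-1.
have pdf0 (r : R) : 0 <= exponential_pdf s^-1 r.
  by rewrite exponential_pdf_ge0// invr_ge0 ltW.
have Cs0 : 0 <= C * s by rewrite mulr_ge0// ltW.
apply: (@le_trans _ _ (\int[lebesgue_measure]_(r in `[0%R, +oo[)
    ((C * s)%:E * (exponential_pdf s^-1 r)%:E))%E); last first.
  rewrite ge0_integralZl//=; last 2 first.
  - by apply/measurable_EFinP; exact: measurable_funTS.
  - by move=> r _; rewrite lee_fin.
  rewrite -[leRHS]mule1; apply: lee_wpmul2l; first by rewrite lee_fin.
  rewrite -(@integral_exponential_pdf R s^-1) ?invr_gt0//.
  apply: ge0_subset_integral => //; first exact/measurable_EFinP.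
  by move=> r _; rewrite lee_fin.
apply: ge0_le_integral => //=.
- by apply: measurable_funTS; exact: ccdf_measurable.
- by apply: emeasurable_funM => //; apply/measurable_EFinP; exact: measurable_funTS.
move=> r /=; rewrite in_itv/= andbT => r0.
rewrite exponential_pdfE// -EFinM mulrA mulfK ?gt_eqF//.
have mtail : measurable [set w | r <= h w] by exact: measurable_set_ge.
have sub : h @^-1` `]r, +oo[ `<=` [set w | r <= h w].
  by move=> w /=; rewrite in_itv/= andbT => /ltW.
have mX : measurable (h @^-1` `]r, +oo[).
  by rewrite -[_ @^-1` _]setTI; exact: (mh measurableT _ (measurable_itv _)).
(* The tail hypothesis covers only [r > 0]; at [r = 0] the bound is [C >= 1]. *)
move: r0; rewrite le_eqVlt => /predU1P[<-|r0].
  by rewrite mulr0 expR0 mulr1 (le_trans (probability_le1 _ _))// lee_fin.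
by apply: (le_probability mX mtail sub); rewrite mulNr [s^-1 * r]mulrC; exact: tail.
Qed.

End Probability.

(** * Product distance on pairs of matrices, and Lipschitz extension *)

Section PairDistance.
Variables (R : realType) (m n : nat).
Implicit Types u v : 'M[R]_(m, n) * 'M[R]_(m, n).

(** Stacking the two differences turns the product norm into a Frobenius norm, which brings the
    triangle inequality with it. *)
Definition pair_dist u v : R := frobenius_norm (col_mx (u.1 - v.1) (u.2 - v.2)).

Lemma pair_distE u v : pair_dist u v =
  Num.sqrt (frobenius_norm (u.1 - v.1) ^+ 2 + frobenius_norm (u.2 - v.2) ^+ 2).
Proof. exact: frobenius_norm_col_mx. Qed.

Lemma pair_dist_ge0 u v : 0 <= pair_dist u v.
Proof. exact: frobenius_norm_ge0. Qed.

Lemma pair_distxx u : pair_dist u u = 0.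
Proof. by rewrite /pair_dist !subrr col_mx0 frobenius_norm0. Qed.

Lemma pair_distC u v : pair_dist u v = pair_dist v u.
Proof. by rewrite !pair_distE frobenius_distC (frobenius_distC u.2). Qed.

Lemma pair_dist_triangle u v w : pair_dist u w <= pair_dist u v + pair_dist v w.
Proof.
rewrite /pair_dist (le_trans _ (frobenius_normD _ _))// add_col_mx.
by rewrite !addrA !subrK.
Qed.

Lemma frobenius_norm_le_pair_dist1 u v :
  frobenius_norm (u.1 - v.1) <= pair_dist u v.
Proof.
rewrite pair_distE -[leLHS](ger0_norm (frobenius_norm_ge0 (u.1 - v.1))) -sqrtr_sqr.
by rewrite ler_wsqrtr// lerDl sqr_ge0.
Qed.

Lemma frobenius_norm_le_pair_dist2 u v :
  frobenius_norm (u.2 - v.2) <= pair_dist u v.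
Proof.
rewrite pair_distE -[leLHS](ger0_norm (frobenius_norm_ge0 (u.2 - v.2))) -sqrtr_sqr.
by rewrite ler_wsqrtr// lerDr sqr_ge0.
Qed.

(* McShane: [h u = sup_{v in G} (g v - L * d(u, v))]. *)
Lemma lipschitz_extension (L : R) (G : set ('M[R]_(m, n) * 'M[R]_(m, n)))
    (g : 'M[R]_(m, n) * 'M[R]_(m, n) -> R) : 0 <= L -> G !=set0 ->
  (forall u v, G u -> G v -> `|g u - g v| <= L * pair_dist u v) ->
  exists2 h : 'M[R]_(m, n) * 'M[R]_(m, n) -> R, forall u, G u -> h u = g u &
    forall u v, `|h u - h v| <= L * pair_dist u v.
Proof.
move=> L0 [v0 Gv0] gL.
pose S u := [set g v - L * pair_dist u v | v in G].
have S0 u : S u !=set0 by exists (g v0 - L * pair_dist u v0), v0.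
have gle v w : G v -> G w -> g v - g w <= L * pair_dist v w.
  by move=> Gv Gw; rewrite (le_trans (ler_norm _))// gL.
have Ssup u : has_sup (S u).
  split; first exact: S0.
  (* Upper bound: [g v <= g v0 + L d(v, v0)] on [G], then the triangle inequality through [u]. *)
  exists (g v0 + L * pair_dist u v0) => _ [v Gv <-].
  rewrite lerBlDr -lerBlDl -[g v0]opprK -?addrA.
  have := gle _ _ Gv Gv0; have := pair_dist_triangle v u v0.
  by move=> /(ler_wpM2l L0); rewrite mulrDr (pair_distC v u); lra.
have hle u v : sup (S u) <= sup (S v) + L * pair_dist u v.
  apply: ge_sup => // _ [w Gw <-].
  have : S v (g v0 - L * pair_dist v v0) by exists v0.
  have : g w - L * pair_dist v w <= sup (S v).
    by apply: sup_upper_bound => //; exists w.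
  have := pair_dist_triangle v u w.
  by move=> /(ler_wpM2l L0); rewrite mulrDr (pair_distC v u); lra.
exists (fun u => sup (S u)) => [u Gu|u v].
  apply/eqP; rewrite eq_le; apply/andP; split.
    apply: ge_sup => // _ [v Gv <-].
    by have := gle _ _ Gv Gu; rewrite (pair_distC v u); lra.
  apply: sup_upper_bound => //; exists u => //.
  by rewrite pair_distxx mulr0 subr0.
rewrite ler_distl; apply/andP; split; last exact: hle.
by rewrite lerBlDr pair_distC hle.
Qed.

End PairDistance.

(** * Concentration, integrability and variance of Lipschitz functions *)

Section Concentration.
Context d (T : measurableType d) (R : realType) (P : probability T R).
Variables (m n : nat).

(** Carries the results on the first matrix over to the second, for the gradient [A^T *m Y *m B]. *)
Lemma lipschitz_conc_E2_swap (X Y : T -> 'M[R]_(m, n)) (C c : R) :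
  lipschitz_conc_E2 P X Y C c -> lipschitz_conc_E2 P Y X C c.
Proof.
move=> conc f flip; apply: (conc (fun u => f (u.2, u.1))) => u v.
by have := flip (u.2, u.1) (v.2, v.1); rewrite [X in Num.sqrt X]addrC.
Qed.

Lemma Rintegral_sum (I : Type) (s : seq I) (F : I -> T -> R) :
  (forall i, P.-integrable setT (EFin \o F i)) ->
  P.-integrable setT (EFin \o (fun w => \sum_(i <- s) F i w)) /\
  \int[P]_w (\sum_(i <- s) F i w) = \sum_(i <- s) \int[P]_w F i w.
Proof.
move=> Fint.
have sint r : P.-integrable setT (EFin \o (fun w => \sum_(i <- r) F i w)).
  have := @integrable_sum _ _ _ P setT _ I r xpredT (fun i => EFin \o F i).
  rewrite (_ : (fun _ => _) = EFin \o (fun w => \sum_(i <- r) F i w)).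
    by apply.
  by apply/funext => w /=; rewrite sumEFin.
split => //; elim: s => [|i s ih].
  rewrite big_nil; under eq_Rintegral do rewrite big_nil.
  by rewrite Rintegral_cst// mul0r.
rewrite big_cons -ih -RintegralD//.
by apply: eq_Rintegral => w _; rewrite big_cons.
Qed.

(** Makes the mean matrix a center common to all linear forms; linearity of the integral is applied
    to the entrywise expansion. *)
Lemma mx_expectation_frobenius_dot (k l : nat) (Z : T -> 'M[R]_(k, l)) B :
  (forall i j, P.-integrable setT (EFin \o (fun w => Z w i j))) ->
  P.-integrable setT (EFin \o (fun w => frobenius_dot B (Z w))) /\
  \int[P]_w frobenius_dot B (Z w) = frobenius_dot B (mx_expectation P Z).
Proof.
move=> Zint.
have BZint i j : P.-integrable setT (EFin \o (fun w => B i j * Z w i j)).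
  by apply: (integrableZl _ (B i j) (Zint i j)).
have -> : (fun w => frobenius_dot B (Z w)) =
    (fun w => \sum_i \sum_j B i j * Z w i j).
  by apply/funext => w; rewrite frobenius_dotE.
have rint i := Rintegral_sum (index_enum 'I_l) (BZint i).
have [zint zE] := Rintegral_sum (index_enum 'I_k) (fun i => (rint i).1).
split => //; rewrite zE frobenius_dotE; apply: eq_bigr => i _.
rewrite (rint i).2; apply: eq_bigr => j _.
by rewrite RintegralZl// mxE unlock.
Qed.

Variables (X Y : T -> 'M[R]_(m, n)) (C c : R).
Hypotheses (C1 : 1 <= C) (c0 : 0 < c) (conc : lipschitz_conc_E2 P X Y C c).
Implicit Types (f : 'M[R]_(m, n) * 'M[R]_(m, n) -> R).

(** The hypothesis is applied to the 1-Lipschitz function [L^-1 * f], at deviation [t / L]. *)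
Lemma lipschitz_conc f (L : R) : 0 < L ->
  (forall u v, `|f u - f v| <= L * pair_dist u v) ->
  P.-integrable setT (fun w => (f (X w, Y w))%:E) /\
  forall t : R, 0 < t ->
    (P [set w | (t <= `|f (X w, Y w) - \int[P]_w' f (X w', Y w')|)%R]
      <= (C * expR (- (t / (L * c)) ^+ 2))%:E)%E.
Proof.
move=> L0 fL.
have [gint gconc] : P.-integrable setT (fun w => (L^-1 * f (X w, Y w))%:E) /\
    forall t : R, 0 < t -> (P [set w | (t <= `|L^-1 * f (X w, Y w) -
      fine 'E_P[fun w' => (L^-1 * f (X w', Y w'))%R]|)%R]
      <= (C * expR (- (t / c) ^+ 2))%:E)%E.
  apply: (conc (f := fun u => L^-1 * f u)) => u v.
  rewrite -mulrBr normrM gtr0_norm ?invr_gt0//.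
  by rewrite ler_pdivrMl// -pair_distE.
have fint : P.-integrable setT (fun w => (f (X w, Y w))%:E).
  have := integrableZl measurableT L gint.
  by under eq_fun do rewrite /= -EFinM mulVKf ?gt_eqF//.
split => // t t0.
have := gconc (L^-1 * t); rewrite mulr_gt0 ?invr_gt0// => /(_ isT).
rewrite unlock -/(Rintegral _ _ _) RintegralZl//.
rewrite (_ : L^-1 * t / c = t / (L * c)); last by rewrite invfM mulrA [t * _]mulrC.
congr (P _ <= _)%E; apply/seteqP; split => w /=;
  by rewrite -mulrBr normrM gtr0_norm ?invr_gt0// ler_pM2l ?invr_gt0.
Qed.

Lemma lipschitz_integrable f (L : R) : 0 <= L ->
  (forall u v, `|f u - f v| <= L * pair_dist u v) ->
  P.-integrable setT (fun w => (f (X w, Y w))%:E).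
Proof.
(* [L + 1] replaces [L] because [L = 0] is allowed here, while [lipschitz_conc] asks for a positive
   constant. *)
move=> L0 fL; apply: (proj1 (@lipschitz_conc f (L + 1) _ _)).
  by rewrite ltr_wpDl.
by move=> u v; rewrite (le_trans (fL u v))// ler_wpM2r ?pair_dist_ge0// lerDl.
Qed.

Lemma lipschitz_measurable f (L : R) : 0 <= L ->
  (forall u v, `|f u - f v| <= L * pair_dist u v) ->
  measurable_fun setT (fun w => f (X w, Y w)).
Proof.
by move=> L0 /(lipschitz_integrable L0) /integrableP[/measurable_EFinP].
Qed.

(** A squared deviation exceeds [t] when the deviation exceeds [sqrt t], so the Gaussian tail
    becomes an exponential tail at scale [(L c)^2], which is integrated. *)
Lemma lipschitz_variance f (L : R) : 0 <= L ->
  (forall u v, `|f u - f v| <= L * pair_dist u v) ->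
  (\int[P]_w ((f (X w, Y w) - \int[P]_w' f (X w', Y w')) ^+ 2)%:E
    <= (C * c ^+ 2 * L ^+ 2)%:E)%E.
Proof.
rewrite le_eqVlt => /predU1P[<- fL|L0 fL].
  (* For [L = 0] the function is constant and the variance is zero. *)
  have fcst w : f (X w, Y w) = f (0, 0).
    have := fL (X w, Y w) (0, 0).
    by rewrite mul0r normr_le0 subr_eq0 => /eqP.
  rewrite (_ : (fun _ => _) = cst 0%E) ?integral0 ?lee_fin ?expr0n ?mulr0//.
  apply/funext => w /=; rewrite fcst.
  under eq_Rintegral do rewrite fcst.
  rewrite Rintegral_cst//= probability_setT mulr1 subrr expr0n//.
have [_ fconc] := lipschitz_conc L0 fL.
rewrite -mulrA; apply: expectation_exponential_tail => //.
- apply: measurable_funX; apply: measurable_funB => //.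
  exact: lipschitz_measurable (ltW L0) fL.
- by move=> w; exact: sqr_ge0.
- by rewrite mulr_gt0 ?exprn_gt0.
move=> t t0; have := fconc (Num.sqrt t); rewrite sqrtr_gt0 => /(_ t0).
rewrite expr_div_n sqr_sqrtr ?(ltW t0)// exprMn (mulrC (L ^+ 2)).
congr (P _ <= _)%E; apply/seteqP; split => w /=.
  by rewrite -sqrtr_sqr ler_sqrt ?sqr_ge0.
by rewrite -sqrtr_sqr ler_sqrt ?sqr_ge0.
Qed.

End Concentration.

(** * Measurability of matrix expressions *)

Section RandomMatrix.
Context d (T : measurableType d) (R : realType).

Lemma random_matrix_cst m n (A : 'M[R]_(m, n)) : random_matrix (fun _ : T => A).
Proof. by move=> i j; exact: measurable_cst. Qed.

Lemma random_matrix_tr m n (X : T -> 'M[R]_(m, n)) :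
  random_matrix X -> random_matrix (fun w => (X w)^T).
Proof.
move=> mX i j; rewrite (_ : (fun _ => _) = fun w => X w j i)//.
by apply/funext => w; rewrite mxE.
Qed.

Lemma random_matrix_mulmx m n k (X : T -> 'M[R]_(m, k))
    (Y : T -> 'M[R]_(k, n)) :
  random_matrix X -> random_matrix Y -> random_matrix (fun w => X w *m Y w).
Proof.
move=> mX mY i j; rewrite (_ : (fun _ => _) = fun w => \sum_l X w i l * Y w l j).
  by apply: measurable_sum => l; exact: measurable_funM.
by apply/funext => w; rewrite mxE.
Qed.

Lemma random_matrix_frobenius_dot m n (X : T -> 'M[R]_(m, n)) B :
  random_matrix X -> measurable_fun setT (fun w => frobenius_dot B (X w)).
Proof.
move=> mX.
rewrite (_ : (fun _ => _) = fun w => \sum_i \sum_j B i j * X w i j).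
  do 2!apply: measurable_sum => ?; apply: measurable_funM => //; exact: mX.
by apply/funext => w; rewrite frobenius_dotE.
Qed.

End RandomMatrix.

(** * Mean and tail of the gradient norms *)

Lemma ge0_bounded_integrable d (T : measurableType d) (R : realType)
    (P : probability T R) (h : T -> R) (b : R) :
  measurable_fun setT h -> (forall w, 0 <= h w) ->
  (\int[P]_w (h w)%:E <= b%:E)%E ->
  P.-integrable setT (EFin \o h) /\ \int[P]_w h w <= b.
Proof.
move=> mh h0 hb.
have hint : P.-integrable setT (EFin \o h).
  apply/integrableP; split; first exact/measurable_EFinP.
  under eq_integral do rewrite /= ger0_norm//.
  exact: le_lt_trans hb (ltry _).
split => //; rewrite -lee_fin /Rintegral fineK//.
exact: integrable_fin_num.
Qed.

(** Bound on the mean gradient norm in units of [|A|_F]: [K] pays for the expectation of [X], and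
    [(C c^2 + 1) / 2] for the fluctuation. *)
Definition gradient_const (R : realType) (C c K : R) : R :=
  (C * c ^+ 2 + 1) / 2 + K.

Section Sandwich.
Context d (T : measurableType d) (R : realType) (P : probability T R).
Variables (m n k l : nat) (X Y : T -> 'M[R]_(m, n)) (C c K : R).
Hypotheses (C1 : 1 <= C) (c0 : 0 < c) (conc : lipschitz_conc_E2 P X Y C c).
Hypothesis EX : frobenius_norm (mx_expectation P X) <= K.
Variables (A : 'M[R]_(k, m)) (B : 'M[R]_(n, l)).
Hypothesis B1 : frobenius_norm B <= 1.

(** The operator bound [a] is left abstract: in the tail estimate it becomes the spectral norm of
    [A], for [A] and [A^T] alike, and the Frobenius norm where only integrability or measurability
    is at stake. *)
Lemma sandwich_lipschitz (a : R) (u v : 'M[R]_(m, n) * 'M[R]_(m, n)) :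
  (forall M : 'M[R]_(m, l), frobenius_norm (A *m M) <= a * frobenius_norm M) ->
  0 <= a ->
  `|frobenius_norm (A *m u.1 *m B) - frobenius_norm (A *m v.1 *m B)|
    <= a * pair_dist u v.
Proof.
move=> aA a0; rewrite (le_trans (frobenius_dist_dist _ _))//.
rewrite -mulmxBl -mulmxBr -mulmxA (le_trans (aA _))// ler_wpM2l//.
rewrite (le_trans (frobenius_normM _ _))//.
by rewrite (le_trans _ (frobenius_norm_le_pair_dist1 u v))// ler_piMr.
Qed.

(** One Lipschitz constant per entry: their squares sum to [|A|_F^2 |B|_F^2], so the total variance
    carries no dimension factor. *)
Lemma sandwich_entry_lipschitz i j (u v : 'M[R]_(m, n) * 'M[R]_(m, n)) :
  `|(A *m u.1 *m B) i j - (A *m v.1 *m B) i j| <=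
  frobenius_norm (row i A) * frobenius_norm (col j B) * pair_dist u v.
Proof.
have -> : (A *m u.1 *m B) i j - (A *m v.1 *m B) i j =
    (A *m (u.1 - v.1) *m B) i j.
  by rewrite mulmxBr mulmxBl !mxE.
rewrite -mulmxA mulmx_entry_dot (le_trans (frobenius_dot_norm _ _))//.
rewrite frobenius_norm_tr -mulrA ler_wpM2l// colE -mulmxA -colE.
rewrite (le_trans (frobenius_normM _ _))// mulrC ler_wpM2l//.
exact: frobenius_norm_le_pair_dist1.
Qed.

Lemma sandwich_entry_expectation i j :
  \int[P]_w (A *m X w *m B) i j = (A *m mx_expectation P X *m B) i j.
Proof.
have dotE (M : 'M[R]_(m, n)) : (A *m M *m B) i j =
    frobenius_dot (A^T *m delta_mx i j *m B^T) M.
  by rewrite frobenius_dotMr trmxK frobenius_dotMl trmxK mulmxA frobenius_dot_delta.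
have Xint i' j' : P.-integrable setT (EFin \o (fun w => X w i' j')).
  have := lipschitz_integrable conc (f := fun u => u.1 i' j') ler01.
  apply => u v; rewrite mul1r (le_trans _ (frobenius_norm_le_pair_dist1 u v))//.
  rewrite -ler_sqr ?nnegrE// real_normK ?num_real//.
  by have := frobenius_norm_entry (u.1 - v.1) i' j'; rewrite !mxE.
under eq_Rintegral do rewrite dotE.
by rewrite dotE (mx_expectation_frobenius_dot _ Xint).2.
Qed.

Lemma sandwich_expectation (s : R) : 0 < s -> frobenius_norm A <= s ->
  \int[P]_w frobenius_norm (A *m X w *m B) <= gradient_const C c K * s.
Proof.
move=> s0 As; rewrite /gradient_const.
have C0 : 0 <= C by rewrite (le_trans _ C1).
pose W i j w := (A *m X w *m B) i j.
pose V i j w := (W i j w - \int[P]_w' W i j w') ^+ 2.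
pose b i j := C * c ^+ 2 *
  (frobenius_norm (row i A) * frobenius_norm (col j B)) ^+ 2.
have Vb i j : P.-integrable setT (EFin \o V i j) /\ \int[P]_w V i j w <= b i j.
  have L0 : 0 <= frobenius_norm (row i A) * frobenius_norm (col j B).
    by rewrite mulr_ge0.
  apply: ge0_bounded_integrable.
  - apply: measurable_funX; apply: measurable_funB => //.
    exact: (lipschitz_measurable conc L0 (sandwich_entry_lipschitz i j)).
  - by move=> w; exact: sqr_ge0.
  - exact: (lipschitz_variance C1 c0 conc L0 (sandwich_entry_lipschitz i j)).
have Vint i := Rintegral_sum (index_enum 'I_l) (fun j => (Vb i j).1).
have [Sint SE] := Rintegral_sum (index_enum 'I_k) (fun i => (Vint i).1).
set S := (fun w => \sum_i \sum_j V i j w) in Sint SE.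
have Sb : \int[P]_w S w <= C * c ^+ 2 * s ^+ 2.
  have -> : \int[P]_w S w = \sum_i \sum_j \int[P]_w V i j w.
    by rewrite SE; apply: eq_bigr => i _; rewrite (Vint i).2.
  apply: (@le_trans _ _ (\sum_i \sum_j b i j)).
    by do 2!(apply: ler_sum => ? _); exact: (Vb _ _).2.
  rewrite -[leLHS](_ : C * c ^+ 2 * (frobenius_norm A * frobenius_norm B) ^+ 2 = _).
    apply: ler_wpM2l; first by rewrite mulr_ge0 ?sqr_ge0.
    rewrite ler_pXn2r ?nnegrE ?mulr_ge0 ?(ltW s0)//.
    by rewrite (le_trans _ As)// ler_piMr.
  rewrite exprMn frobenius_norm_row frobenius_norm_col mulr_suml mulr_sumr.
  apply: eq_bigr => i _; rewrite !mulr_sumr; apply: eq_bigr => j _.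
  by rewrite -exprMn.
have SnormE w : S w =
    frobenius_norm (A *m X w *m B - A *m mx_expectation P X *m B) ^+ 2.
  rewrite frobenius_norm_sum; do 2!apply: eq_bigr => ? _.
  by rewrite /V /W sandwich_entry_expectation !mxE.
have normS w : frobenius_norm (A *m X w *m B) <=
    (s / 2 + K * s) + (2 * s)^-1 * S w.
  set Z := A *m X w *m B; set EZ := A *m mx_expectation P X *m B.
  have -> : Z = (Z - EZ) + EZ by rewrite subrK.
  rewrite (le_trans (frobenius_normD _ _))// SnormE -/Z -/EZ.
  have EZK : frobenius_norm EZ <= K * s.
    rewrite (le_trans (frobenius_normM _ _))//.
    apply: (@le_trans _ _ (frobenius_norm (A *m mx_expectation P X))).
      by rewrite ler_piMr.
    by rewrite (le_trans (frobenius_normM _ _))// mulrC ler_pM.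
  set D := frobenius_norm (Z - EZ).
  (* From the second moment to the first: the inequality amounts to [(s - D)^2 >= 0], and the second
     moment of [D] is at most [C c^2 s^2]. *)
  suff : D <= s / 2 + (2 * s)^-1 * D ^+ 2 by lra.
  rewrite -subr_ge0 (_ : _ - _ = (2 * s)^-1 * (s - D) ^+ 2).
    by rewrite mulr_ge0 ?sqr_ge0// invr_ge0 mulr_ge0// ltW.
  by field; rewrite gt_eqF.
have Zint : P.-integrable setT
    (EFin \o (fun w => frobenius_norm (A *m X w *m B))).
  apply: (lipschitz_integrable conc (frobenius_norm_ge0 A)
    (f := fun u => frobenius_norm (A *m u.1 *m B))) => u v.
  by apply: sandwich_lipschitz => // M; exact: frobenius_normM.
have cint : P.-integrable setT (EFin \o cst (s / 2 + K * s)).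
  exact: finite_measure_integrable_cst.
have S2int : P.-integrable setT (EFin \o (fun w => (2 * s)^-1 * S w)).
  exact: (integrableZl _ (2 * s)^-1 Sint).
apply: (@le_trans _ _ (\int[P]_w (s / 2 + K * s + (2 * s)^-1 * S w))).
  apply: le_Rintegral => //.
  exact: (integrableD measurableT cint S2int).
rewrite RintegralD// Rintegral_cst//= probability_setT mulr1 RintegralZl//.
have : (2 * s)^-1 * \int[P]_w S w <= (2 * s)^-1 * (C * c ^+ 2 * s ^+ 2).
  by rewrite ler_wpM2l// invr_ge0 mulr_ge0// ltW.
rewrite (_ : _ * (_ * s ^+ 2) = C * c ^+ 2 / 2 * s); first lra.
by field; rewrite gt_eqF.
Qed.

(** The norm is an [a]-Lipschitz function of [X] with mean at most [gradient_const C c K * s], taken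
    at deviation [r * a]. Asking only [|A|_F <= s] lets [A^T] share the [s] of [A]. *)
Lemma sandwich_tail (s a r : R) : 0 < s -> frobenius_norm A <= s -> 0 < a ->
  (forall M : 'M[R]_(m, l), frobenius_norm (A *m M) <= a * frobenius_norm M) ->
  0 < r ->
  (P [set w | (gradient_const C c K * s + r * a
                 <= frobenius_norm (A *m X w *m B))%R]
    <= (C * expR (- (r / c) ^+ 2))%:E)%E.
Proof.
move=> s0 As a0 aA r0.
have lip u v := @sandwich_lipschitz a u v aA (ltW a0).
have [_ ZP] := lipschitz_conc conc
  (f := fun u => frobenius_norm (A *m u.1 *m B)) a0 lip.
have mZ := lipschitz_measurable conc
  (f := fun u => frobenius_norm (A *m u.1 *m B)) (ltW a0) lip.
have := ZP (r * a) (mulr_gt0 r0 a0).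
have -> : r * a / (a * c) = r / c by field; rewrite ?gt_eqF.
apply: le_probability.
- exact: measurable_set_ge.
- apply: measurable_set_ge; apply: measurableT_comp => //.
  exact: measurable_funB.
move=> w /= rZ; rewrite (le_trans _ (ler_norm _))// lerBrDl (le_trans _ rZ)//.
by rewrite lerD2r sandwich_expectation.
Qed.

End Sandwich.

(** * Concentration of the bilinear form, and its constants *)

Definition radius_const (R : realType) (C c : R) : R := 8 * C * c.

(** With [rho] and [K0] the radius and gradient constants and [r = sqrt (t / |A|)]: for [t] above
    this multiple of [|A|_F], the first term gives [4 rho K0 |A|_F <= t / 4], the second [rho <= r]
    and [4 rho r |A| <= t / 4]. The center then moves by at most [t / 2]. *)
Definition threshold_const (R : realType) (C c K : R) : R :=
  16 * radius_const C c * gradient_const C c K + 256 * radius_const C c ^+ 2.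

(** [8 c K0] serves the Gaussian regime, where [K0 |A|_F] dominates [L r], and [64 c^2] the
    exponential regime, where [r |A|] does. *)
Definition scale_const (R : realType) (C c K : R) : R :=
  8 * c * gradient_const C c K + 64 * c ^+ 2.

(** Prefactor times scale of the tail in [deviation_exponential_tail], in units of [|A|_F]. *)
Definition mean_const (R : realType) (C c K : R) : R :=
  (3 * C * (expR 1 + 1) + expR (threshold_const C c K / scale_const C c K))
  * scale_const C c K.

(** [3 C] serves large [t]; the exponential raises the bound to at least 1 for [t] below
    [2 (mean_const + threshold_const) |A|_F]. *)
Definition deviation_const (R : realType) (C c K : R) : R :=
  3 * C + expR (((mean_const C c K + threshold_const C c K)
                 / scale_const C c K) ^+ 2).

Section HansonWright.
Context d (T : measurableType d) (R : realType) (P : probability T R).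
Variables (m n : nat) (X Y : T -> 'M[R]_(m, n)) (C c K : R).
Hypotheses (C1 : 1 <= C) (c0 : 0 < c) (conc : lipschitz_conc_E2 P X Y C c).
Hypotheses (mX : random_matrix X) (mY : random_matrix Y).
Hypotheses (EX : frobenius_norm (mx_expectation P X) <= K)
           (EY : frobenius_norm (mx_expectation P Y) <= K).
Variables (A : 'M[R]_m) (B : 'M[R]_n).
Hypothesis B1 : frobenius_norm B <= 1.

Let g (u : 'M[R]_(m, n) * 'M[R]_(m, n)) : R :=
  frobenius_dot B (u.2^T *m A *m u.1).
Local Notation s := (frobenius_norm A).
Local Notation a := (spectral_norm A).
Local Notation rho := (radius_const C c).
Local Notation tau := (threshold_const C c K).
Local Notation c1 := (scale_const C c K).
Local Notation K0 := (gradient_const C c K).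
Let L r := K0 * s + r * a.
Hypothesis a0 : 0 < a.

Let s0 : 0 < s.
Proof. exact: lt_le_trans a0 (spectral_norm_le_frobenius A). Qed.
Let C0 : 0 < C. Proof. exact: lt_le_trans ltr01 C1. Qed.
Let K_ge0 : 0 <= K. Proof. exact: le_trans (frobenius_norm_ge0 _) EX. Qed.
Let K0_gt0 : 0 < K0.
Proof. by rewrite ltr_wpDr// divr_gt0// ltr_wpDl// mulr_ge0 ?sqr_ge0// ltW. Qed.
Let L_gt0 r : 0 < r -> 0 < L r.
Proof. by move=> r0; rewrite addr_gt0// mulr_gt0. Qed.

Let gradient_bounded r (u : 'M[R]_(m, n) * 'M[R]_(m, n)) :=
  frobenius_norm (A *m u.1 *m B^T) <= L r /\
  frobenius_norm (A^T *m u.2 *m B) <= L r.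

Let measurable_g : measurable_fun setT (fun w => g (X w, Y w)).
Proof.
apply: random_matrix_frobenius_dot; apply: random_matrix_mulmx => //.
apply: random_matrix_mulmx; first exact: random_matrix_tr.
exact: random_matrix_cst.
Qed.

(** Bilinearity gives the exact increment [<u2 - v2, A u1 B^T> + <u1 - v1, A^T v2 B>], with one
    gradient taken at [u] and the other at [v]. *)
Lemma bilinear_form_lipschitz r u v :
  gradient_bounded r u -> gradient_bounded r v ->
  `|g u - g v| <= 2 * L r * pair_dist u v.
Proof.
move=> [u1 _] [_ v2].
have -> : g u - g v = frobenius_dot (u.2 - v.2) (A *m u.1 *m B^T) +
    frobenius_dot (u.1 - v.1) (A^T *m v.2 *m B).
  have gY w : g w = frobenius_dot w.2 (A *m w.1 *m B^T).
    by rewrite /g -mulmxA -frobenius_dotMl frobenius_dotMr.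
  have gX x y : frobenius_dot y (A *m x *m B^T) =
      frobenius_dot x (A^T *m y *m B).
    by rewrite -frobenius_dotMr frobenius_dotC frobenius_dotMl mulmxA.
  by rewrite !gY frobenius_dotBl frobenius_dotBl -!gX subrKA.
rewrite mulrDl mul1r mulrDl (le_trans (ler_normD _ _))// lerD//.
  rewrite (le_trans (frobenius_dot_norm _ _))// mulrC ler_pM//.
  exact: frobenius_norm_le_pair_dist2.
rewrite (le_trans (frobenius_dot_norm _ _))// mulrC ler_pM//.
exact: frobenius_norm_le_pair_dist1.
Qed.

Let gradient_tail r : 0 < r ->
  (P [set w | (L r <= frobenius_norm (A *m X w *m B^T))%R]
    <= (C * expR (- (r / c) ^+ 2))%:E)%E /\
  (P [set w | (L r <= frobenius_norm (A^T *m Y w *m B))%R]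
    <= (C * expR (- (r / c) ^+ 2))%:E)%E.
Proof.
move=> r0; split.
  apply: (sandwich_tail C1 c0 conc EX) => //; first by rewrite frobenius_norm_tr.
  by move=> M; exact: spectral_norm_mulmx.
apply: (sandwich_tail C1 c0 (lipschitz_conc_E2_swap conc) EY) => //.
  by rewrite frobenius_norm_tr.
by move=> M; exact: spectral_norm_trmulmx.
Qed.


Let rho_gt0 : 0 < rho. Proof. by rewrite !mulr_gt0. Qed.

(** The reason for [radius_const]: with [x = r / c >= 8 C], [exp (x^2) >= 1 + x^2 >= 2 x >= 8 C].
    The value 1/8 keeps the bad gradient event below 1/4 and the two events of [center_drift] below
    3/4 in all. *)
Let rho_tail r : rho <= r -> C * expR (- (r / c) ^+ 2) <= 8^-1.
Proof.
move=> rr; have x8 : 8 * C <= r / c by rewrite ler_pdivlMr.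
have e8 : 8 * C <= expR ((r / c) ^+ 2).
  rewrite (le_trans _ (expR_ge1Dx _))//.
  by have := sqr_ge0 (r / c - 1); have := C1; rewrite sqrrB expr1n mulr1; lra.
have := ler_wpM2r (expR_ge0 (- (r / c) ^+ 2)) e8.
by rewrite -expRD subrr expR0; lra.
Qed.

(* [g] coincides with a [2 * L r]-Lipschitz function on the event that both
   gradients are at most [L r]; the mean of that function serves as center. *)
Let truncated_concentration r : rho <= r -> exists M, forall t, 0 < t ->
  (P [set w | (t <= `|g (X w, Y w) - M|)%R]
    <= (C * expR (- (t / (2 * L r * c)) ^+ 2)
        + 2 * (C * expR (- (r / c) ^+ 2)))%:E)%E.
Proof.
move=> rr; have r0 : 0 < r by exact: lt_le_trans rr.
have [tX tY] := gradient_tail r0.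
set BX := [set w | _] in tX; set BY := [set w | _] in tY.
have mXB : measurable_fun setT (fun w => frobenius_norm (A *m X w *m B^T)).
  apply: (lipschitz_measurable conc (frobenius_norm_ge0 A)
    (f := fun u => frobenius_norm (A *m u.1 *m B^T))) => u v.
  apply: sandwich_lipschitz => //; first by rewrite frobenius_norm_tr.
  by move=> N; exact: frobenius_normM.
have mYB : measurable_fun setT (fun w => frobenius_norm (A^T *m Y w *m B)).
  apply: (lipschitz_measurable (lipschitz_conc_E2_swap conc)
    (frobenius_norm_ge0 A^T)
    (f := fun u => frobenius_norm (A^T *m u.1 *m B))) => u v.
  by apply: sandwich_lipschitz => // N; exact: frobenius_normM.
have mBX : measurable BX by exact: measurable_set_ge.
have mBY : measurable BY by exact: measurable_set_ge.
have mBXY : measurable (BX `|` BY) by exact: measurableU.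
have PBXY : (P (BX `|` BY) <= (2 * (C * expR (- (r / c) ^+ 2)))%:E)%E.
  rewrite mulrDl !mul1r.
  by apply: (probability_union_bound mBXY mBX mBY _ tX tY).
have good w : ~ (BX `|` BY) w -> gradient_bounded r (X w, Y w).
  move=> nB; split; rewrite leNgt; apply/negP => /ltW ?; apply: nB.
    by left.
  by right.
have L2 : 0 < 2 * L r by rewrite mulr_gt0// L_gt0.
(* A sample point off the bad event makes the domain of the extension nonempty. *)
have [w0 Bw0] : exists w, ~ (BX `|` BY) w.
  apply: (exists_notin_of_probability_lt1 mBXY PBXY).
  by have := rho_tail rr; lra.
have [h hg hL] := lipschitz_extension (ltW L2)
  (ex_intro _ (X w0, Y w0) (good _ Bw0)) (@bilinear_form_lipschitz r).
have [hint hconc] := lipschitz_conc conc L2 hL.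
exists (\int[P]_w h (X w, Y w)) => t t0.
have mh := lipschitz_measurable conc (ltW L2) hL.
apply: (probability_union_bound _ _ mBXY _ (hconc t t0) PBXY).
- apply: measurable_set_ge; apply: measurableT_comp => //.
  exact: measurable_funB.
- apply: measurable_set_ge; apply: measurableT_comp => //.
  exact: measurable_funB.
move=> w /= tw; have [Bw|/good Gw] := pselect ((BX `|` BY) w); first by right.
by left => /=; rewrite hg.
Qed.

(** Deviation [2 rho L z] turns the exponent into [(rho / c)^2] for each radius [z], so both events
    have probability at most 3/8. A sample point outside both puts the centers within
    [2 rho (L r + L rho) <= 4 rho L r]. *)
Let center_drift r M M0 : rho <= r ->
  (forall t, 0 < t -> (P [set w | (t <= `|g (X w, Y w) - M|)%R]
    <= (C * expR (- (t / (2 * L r * c)) ^+ 2)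
        + 2 * (C * expR (- (r / c) ^+ 2)))%:E)%E) ->
  (forall t, 0 < t -> (P [set w | (t <= `|g (X w, Y w) - M0|)%R]
    <= (C * expR (- (t / (2 * L rho * c)) ^+ 2)
        + 2 * (C * expR (- (rho / c) ^+ 2)))%:E)%E) ->
  `|M - M0| <= 4 * rho * L r.
Proof.
move=> rr cM cM0; have r0 : 0 < r by exact: lt_le_trans rr.
have mB t N : measurable [set w | t <= `|g (X w, Y w) - N|].
  apply: measurable_set_ge; apply: measurableT_comp => //.
  exact: measurable_funB.
have scale z : 0 < z -> 2 * rho * L z / (2 * L z * c) = rho / c.
  by move=> z0; field; rewrite ?gt_eqF// L_gt0.
have Bz z : 0 < z -> 0 < 2 * rho * L z by move=> z0; rewrite !mulr_gt0// L_gt0.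
have := cM _ (Bz _ r0); have := cM0 _ (Bz _ rho_gt0).
rewrite !scale// => P0 P1.
have mU := measurableU _ _ (mB (2 * rho * L rho) M0) (mB (2 * rho * L r) M).
have PU := probability_union_bound mU (mB _ _) (mB _ _) (@subset_refl _ _) P0 P1.
have [|w] := exists_notin_of_probability_lt1 mU PU.
  by have := rho_tail rr; have := rho_tail (lexx rho); lra.
move=> /not_orP[/= /negP + /negP]; rewrite -!ltNge => w0 w1.
have LL : L rho <= L r by rewrite lerD2l ler_wpM2r// ltW.
have := ler_wpM2l (ltW rho_gt0) LL.
rewrite (_ : M - M0 = (g (X w, Y w) - M0) - (g (X w, Y w) - M)); last by ring.
have := ler_normB (g (X w, Y w) - M0) (g (X w, Y w) - M); lra.
Qed.

Let c1_gt0 : 0 < c1.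
Proof. by rewrite addr_gt0 ?mulr_gt0 ?exprn_gt0. Qed.
Let tau_gt0 : 0 < tau.
Proof. by rewrite addr_gt0 ?mulr_gt0 ?exprn_gt0. Qed.

Let measurable_deviation t N : measurable [set w | t <= `|g (X w, Y w) - N|].
Proof.
apply: measurable_set_ge; apply: measurableT_comp => //.
exact: measurable_funB.
Qed.

(* The choice [r = sqrt (t / a)] balances the two terms of
   [truncated_concentration]. *)
Let concentration_off_center : exists M, forall t, tau * s <= t ->
  (P [set w | (t <= `|g (X w, Y w) - M|)%R]
    <= (3 * C * (expR (- (t / (c1 * s)) ^+ 2) + expR (- (t / (c1 * a)))))%:E)%E.
Proof.
(* The fixed center is that of the smallest radius; only the auxiliary radius [r] depends on [t]. *)
have [M0 cM0] := truncated_concentration (lexx rho).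
exists M0 => t ts; have t0 : 0 < t by apply: lt_le_trans ts; rewrite mulr_gt0.
have as_ : a <= s := spectral_norm_le_frobenius A.
pose r := Num.sqrt (t / a).
have r2 : r ^+ 2 = t / a by rewrite sqr_sqrtr// divr_ge0// ltW.
have ra2 : (r * a) ^+ 2 = t * a by rewrite exprMn r2; field; rewrite gt_eqF.
have r_ge0 : 0 <= r by exact: sqrtr_ge0.
have ra_ge0 : 0 <= r * a by rewrite mulr_ge0// ltW.
have rho_s : 16 * rho * K0 * s + 256 * rho ^+ 2 * s <= t.
  by rewrite -mulrDl.
have rhoK_s : 0 <= 16 * rho * K0 * s by rewrite !mulr_ge0// ltW.
have rho2_s : 0 <= 256 * rho ^+ 2 * s by rewrite !mulr_ge0 ?sqr_ge0// ltW.
have rho2_a : 256 * rho ^+ 2 * a <= t.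
  have : 256 * rho ^+ 2 * a <= 256 * rho ^+ 2 * s.
    by rewrite ler_wpM2l// mulr_ge0 ?sqr_ge0.
  by lra.
have rr : rho <= r.
  rewrite -(@ler_pXn2r _ 2) ?nnegrE ?(ltW rho_gt0)// r2 ler_pdivlMr//.
  by have := mulr_ge0 (sqr_ge0 rho) (ltW a0); lra.
have r0 : 0 < r by exact: lt_le_trans rr.
have [M cM] := truncated_concentration rr.
have drift := center_drift rr cM cM0.
(* Compared through squares: [(16 rho r a)^2 = t * (256 rho^2 a) <= t^2]. *)
have rho_ra : 16 * rho * (r * a) <= t.
  have ra16_ge0 := mulr_ge0 (mulr_ge0 (ler0n R 16) (ltW rho_gt0)) ra_ge0.
  rewrite -(@ler_pXn2r _ 2) ?nnegrE ?(ltW t0)//.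
  rewrite exprMn ra2 (_ : _ * (t * a) = t * (256 * rho ^+ 2 * a)); last by ring.
  by rewrite expr2 ler_pM2l.
have half_t : 4 * rho * L r <= t / 2 by rewrite /L; lra.
have t2 : 0 < t / 2 by rewrite divr_gt0.
(* Half of [t] pays for the move from [M0] to [M]; the other half is a deviation from [M]. *)
apply: (@le_probability _ _ _ P _ _ _ (measurable_deviation _ _)
  (measurable_deviation _ _) _ (le_trans (cM _ t2) _)).
  move=> w /= tw.
  have := ler_normB (g (X w, Y w) - M) (M0 - M).
  rewrite (_ : g (X w, Y w) - M - (M0 - M) = g (X w, Y w) - M0); last by ring.
  by rewrite (distrC M0 M); lra.
rewrite lee_fin.
have tailr : expR (- (r / c) ^+ 2) <= expR (- (t / (c1 * a))).
  rewrite ler_expR lerN2 expr_div_n r2 -mulrA -invfM.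
  rewrite ler_wpM2l ?(ltW t0)// lef_pV2 ?posrE ?mulr_gt0 ?exprn_gt0//.
  rewrite mulrC ler_wpM2r ?(ltW a0)//.
  by rewrite /scale_const; have := mulr_gt0 c0 K0_gt0; have := sqr_ge0 c; lra.
have tailL : expR (- (t / 2 / (2 * L r * c)) ^+ 2) <=
    expR (- (t / (c1 * s)) ^+ 2) + expR (- (t / (c1 * a))).
  (* If [K0 s] dominates, [L r <= 2 K0 s] and the tail is Gaussian. Otherwise [L r <= 2 r a], and
     the square of [t / (8 c r a)] is [t / (64 c^2 a)]. *)
  have [sL|Ls] := lerP (r * a) (K0 * s).
    apply: ler_wpDr; first exact: expR_ge0.
    rewrite ler_expR lerN2 ler_pXn2r ?nnegrE//; last 2 first.
    - by rewrite divr_ge0 ?(ltW t0)// mulr_ge0// ltW.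
    - by rewrite !divr_ge0 ?(ltW t0) ?mulr_ge0 ?(ltW c0) ?(ltW (L_gt0 _)).
    rewrite -mulrA -invfM ler_wpM2l ?(ltW t0)//.
    rewrite lef_pV2 ?posrE ?mulr_gt0 ?L_gt0//.
    rewrite (_ : 2 * (2 * L r * c) = 4 * c * L r); last by ring.
    have : 4 * c * L r <= 4 * c * (2 * (K0 * s)).
      by rewrite ler_wpM2l ?mulr_ge0 ?(ltW c0)// /L; lra.
    have : 0 <= c ^+ 2 * s by rewrite mulr_ge0 ?sqr_ge0.
    by rewrite /scale_const; lra.
  apply: ler_wpDl; first exact: expR_ge0.
  rewrite ler_expR lerN2.
  have Lra : L r <= 2 * (r * a) by rewrite /L; lra.
  have ra_gt0 : 0 < r * a by rewrite mulr_gt0.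
  apply: (@le_trans _ _ ((t / (8 * c * (r * a))) ^+ 2)).
    rewrite expr_div_n exprMn ra2.
    rewrite (_ : t ^+ 2 / _ = t / (64 * c ^+ 2 * a)); last first.
      by field; rewrite ?gt_eqF.
    rewrite ler_wpM2l ?(ltW t0)// lef_pV2 ?posrE ?mulr_gt0 ?exprn_gt0//.
    rewrite ler_wpM2r ?(ltW a0)//.
    by rewrite /scale_const; have := mulr_gt0 c0 K0_gt0; lra.
  rewrite ler_pXn2r ?nnegrE//; last 2 first.
  - by rewrite divr_ge0 ?(ltW t0)// !mulr_ge0// ltW.
  - by rewrite !divr_ge0 ?(ltW t0) ?mulr_ge0 ?(ltW c0) ?(ltW (L_gt0 _)).
  rewrite -[leRHS]mulrA -invfM ler_wpM2l ?(ltW t0)//.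
  rewrite lef_pV2 ?posrE ?mulr_gt0 ?L_gt0//.
  have : 4 * c * L r <= 4 * c * (2 * (r * a)).
    by rewrite ler_wpM2l ?mulr_ge0 ?(ltW c0).
  by lra.
have := ler_wpM2l (ltW C0) tailr; have := ler_wpM2l (ltW C0) tailL.
have := mulr_ge0 (ltW C0) (expR_ge0 (- (t / (c1 * s)) ^+ 2)).
by rewrite mulrDr; lra.
Qed.

(** A cruder tail, ready for integration: [exp (- x^2) <= e * exp (- x)], [|A| <= |A|_F] merges the
    scales, and for [t < tau |A|_F] the factor [exp (tau / c1)] makes the bound at least 1. *)
Let deviation_exponential_tail M :
  (forall t, tau * s <= t -> (P [set w | (t <= `|g (X w, Y w) - M|)%R]
    <= (3 * C * (expR (- (t / (c1 * s)) ^+ 2)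
                 + expR (- (t / (c1 * a)))))%:E)%E) ->
  forall t, 0 < t -> (P [set w | (t <= `|g (X w, Y w) - M|)%R]
    <= ((3 * C * (expR 1 + 1) + expR (tau / c1))
        * expR (- (t / (c1 * s))))%:E)%E.
Proof.
move=> cM t t0; set x := t / (c1 * s).
have C3 : 0 <= 3 * C by rewrite mulr_ge0// ltW.
have [ts|st] := lerP (tau * s) t.
  apply: (le_trans (cM t ts)); rewrite lee_fin -/x.
  have e1 : expR (- x ^+ 2) <= expR 1 * expR (- x).
    rewrite -expRD ler_expR.
    by have := sqr_ge0 (x - 1); have := sqr_ge0 x; rewrite sqrrB expr1n mulr1; lra.
  have e2 : expR (- (t / (c1 * a))) <= expR (- x).
    rewrite ler_expR lerN2 ler_wpM2l ?(ltW t0)//.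
    rewrite lef_pV2 ?posrE ?mulr_gt0// ler_wpM2l ?(ltW c1_gt0)//.
    exact: spectral_norm_le_frobenius.
  rewrite [leRHS]mulrDl ler_wpDr ?expR_ge0 ?mulr_ge0 ?expR_ge0//.
  rewrite -[leRHS]mulrA; apply: ler_wpM2l => //.
  by rewrite [leRHS]mulrDl mul1r lerD.
rewrite (le_trans (probability_le1 P (measurable_deviation _ _)))// lee_fin.
rewrite [leRHS]mulrDl ler_wpDl//.
  by rewrite mulr_ge0 ?expR_ge0// mulr_ge0// addr_ge0 ?expR_ge0.
rewrite -expRD -[leLHS]expR0 ler_expR subr_ge0 /x invfM mulrA.
rewrite [t / c1]mulrC -mulrA mulrC ler_wpM2r ?invr_ge0 ?(ltW c1_gt0)//.
by rewrite ler_pdivrMr// ltW.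
Qed.

(** The first moment of the deviation from [M] bounds the distance from [M] to the mean; this change
    of center costs half of [t], hence the factor 2 in the scales. *)
Lemma bilinear_form_concentration :
  P.-integrable setT (EFin \o (fun w => g (X w, Y w))) /\
  forall t, 0 < t ->
    (P [set w | (t <= `|g (X w, Y w) - \int[P]_w' g (X w', Y w')|)%R]
    <= (deviation_const C c K * (expR (- (t / (2 * c1 * s)) ^+ 2)
                 + expR (- (t / (2 * c1 * a)))))%:E)%E.
Proof.
have [M cM] := concentration_off_center.
have mh : measurable_fun setT (fun w => `|g (X w, Y w) - M|).
  by apply: measurableT_comp => //; exact: measurable_funB.
have [hint hmean] : P.-integrable setT (EFin \o (fun w => `|g (X w, Y w) - M|)) /\
    \int[P]_w `|g (X w, Y w) - M| <= mean_const C c K * s.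
  apply: ge0_bounded_integrable => //.
  rewrite /mean_const -mulrA.
  apply: expectation_exponential_tail => //; last 2 first.
  - by rewrite mulr_gt0.
  - exact: deviation_exponential_tail.
  have := expR_gt0 (tau / c1); have := C1.
  have := mulr_ge0 (ltW C0) (expR_ge0 1); lra.
have gMint : P.-integrable setT (EFin \o (fun w => g (X w, Y w) - M)).
  apply: le_integrable hint => //.
    by apply/measurable_EFinP; exact: measurable_funB.
  by move=> w _; rewrite /= normr_id.
have Mint : P.-integrable setT (EFin \o cst M).
  exact: finite_measure_integrable_cst.
have gint : P.-integrable setT (EFin \o (fun w => g (X w, Y w))).
  have := integrableD measurableT gMint Mint.
  by under eq_fun do rewrite /= -EFinD subrK.
split => // t t0.
set E := \int[P]_w' g (X w', Y w').
have EM : `|E - M| <= mean_const C c K * s.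
  have -> : E - M = \int[P]_w (g (X w, Y w) - M).
    by rewrite RintegralB// Rintegral_cst//= probability_setT mulr1.
  exact: le_trans (le_normr_Rintegral _ gMint) hmean.
have D0 : 0 <= mean_const C c K * s by rewrite (le_trans _ EM).
have dev0 : 0 <= deviation_const C c K.
  by rewrite addr_ge0 ?expR_ge0// mulr_ge0// ltW.
(* Above this threshold [t / 2] covers the distance to the mean and is at least [tau * s]; below it
   the right-hand side is at least 1. *)
have [ts|st] := lerP (2 * (mean_const C c K + tau) * s) t.
  have tau2 : 0 <= tau * s by rewrite mulr_ge0// ltW.
  have ts2 : tau * s <= t / 2 by lra.
  apply: (@le_probability _ _ _ P _ _ _ (measurable_deviation _ _)
    (measurable_deviation _ _) _ (le_trans (cM _ ts2) _)).
    move=> w /= tw; have := ler_normD (g (X w, Y w) - M) (M - E).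
    by rewrite addrA subrK (distrC M E); lra.
  rewrite lee_fin -!(mulrA 2) !(invfM 2) !(mulrA t).
  by rewrite ler_wpM2r ?addr_ge0 ?expR_ge0// /deviation_const lerDl expR_ge0.
rewrite (le_trans (probability_le1 P (measurable_deviation _ _)))// lee_fin.
rewrite [leRHS]mulrDr ler_wpDr//; first by rewrite mulr_ge0 ?expR_ge0.
rewrite /deviation_const [leRHS]mulrDl ler_wpDl//.
  by rewrite !mulr_ge0 ?expR_ge0// ltW.
rewrite -expRD -[leLHS]expR0 ler_expR subr_ge0.
have ms : 0 <= mean_const C c K + tau.
  by rewrite addr_ge0// ?(ltW tau_gt0)// -(pmulr_lge0 _ s0).
rewrite ler_pXn2r ?nnegrE//; last 2 first.
- by rewrite divr_ge0 ?(ltW t0)// !mulr_ge0// ltW.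
- by rewrite divr_ge0 ?(ltW c1_gt0).
rewrite ler_pdivrMr ?mulr_gt0// (_ : _ / c1 * _ = 2 * (mean_const C c K + tau) * s).
  exact: ltW.
by field; rewrite gt_eqF.
Qed.

End HansonWright.

(** * Linear concentration around the mean matrix *)

Lemma lipschitz_conc_E2_weaken d (T : measurableType d) (R : realType)
    (P : probability T R) m n (X Y : T -> 'M[R]_(m, n)) (C C' c : R) :
  C <= C' -> lipschitz_conc_E2 P X Y C c -> lipschitz_conc_E2 P X Y C' c.
Proof.
move=> CC' conc f /conc[fint fconc]; split => // t t0.
by rewrite (le_trans (fconc t t0))// lee_fin ler_wpM2r// expR_ge0.
Qed.

Lemma exp_tail2 (R : realType) (s t : R) : 0 < s -> 0 < t ->
  exp_tail 2 s t = expR (- (t / s) ^+ 2).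
Proof.
by move=> s0 t0; rewrite /exp_tail gt_eqF// powR_mulrn// divr_ge0// ltW.
Qed.

Lemma exp_tail1 (R : realType) (s t : R) : 0 < s -> 0 < t ->
  exp_tail 1 s t = expR (- (t / s)).
Proof.
by move=> s0 t0; rewrite /exp_tail gt_eqF// powRr1// divr_ge0// ltW.
Qed.

Lemma bilinear_form_linear_conc d (T : measurableType d) (R : realType)
    (P : probability T R) m n (X Y : T -> 'M[R]_(m, n)) (C c K : R)
    (A : 'M[R]_m) :
  1 <= C -> 0 < c -> lipschitz_conc_E2 P X Y C c ->
  random_matrix X -> random_matrix Y ->
  frobenius_norm (mx_expectation P X) <= K ->
  frobenius_norm (mx_expectation P Y) <= K ->
  0 < scale_const C c K ->
  linear_conc P (@frobenius_norm R n n) (fun w => (Y w)^T *m A *m X w)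
    [:: (2, frobenius_norm A); (1, spectral_norm A)]
    (deviation_const C c K) (2 * scale_const C c K).
Proof.
move=> C1 c0 conc mX mY EX EY sc0.
have dev0 : 0 <= deviation_const C c K.
  by rewrite addr_ge0 ?expR_ge0// mulr_ge0// (le_trans ler01).
(* For [A = 0] both tails are 0 by the convention of [exp_tail]; the product vanishes, so the
   deviation event around 0 is empty. *)
have [/eqP /spectral_norm_eq0 ->|a0] := boolP (spectral_norm A == 0).
  exists 0 => f _ t t0; rewrite (_ : [set w | _] = set0).
    rewrite measure0 lee_fin mulr_ge0//; apply: sumr_ge0 => -[q s] _.
    by rewrite /exp_tail; case: ifP => // _; exact: expR_ge0.
  apply/seteqP; split => w //=.
  by rewrite mulmx0 mul0mx subrr normr0 leNgt t0.
have {}a0 : 0 < spectral_norm A by rewrite lt_def a0 spectral_norm_ge0.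
have s0 : 0 < frobenius_norm A.
  exact: lt_le_trans a0 (spectral_norm_le_frobenius A).
pose Z w := (Y w)^T *m A *m X w.
have Zconc B (B1 : frobenius_norm B <= 1) :=
  bilinear_form_concentration C1 c0 conc mX mY EX EY B1 a0.
have Zint i j : P.-integrable setT (EFin \o (fun w => Z w i j)).
  (* Matrix units are admissible as [B], which makes the entries of [Z] integrable. *)
  have d1 : frobenius_norm (delta_mx i j : 'M[R]_n) <= 1.
    by rewrite -(@ler_pXn2r _ 2)// ?nnegrE// frobenius_normK
      frobenius_dot_delta mxE !eqxx expr1n.
  have := (Zconc _ d1).1.
  by under eq_fun do rewrite frobenius_dot_delta.
(* The center is fixed before [f]; for each [f] its image is the mean of [f (Z w)]. *)
exists (mx_expectation P Z) => f /scalar_frobenius_dot[B B1 fB] t t0.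
rewrite !big_cons big_nil addr0 /= exp_tail2 ?exp_tail1 ?mulr_gt0//.
rewrite fB -(mx_expectation_frobenius_dot B Zint).2.
under eq_set do rewrite fB.
exact: (Zconc _ B1).2.
Qed.

Theorem proposition6p1 (R : realType)
  (d : nat -> nat -> measure_display)
  (T : forall p n : nat, measurableType (d p n))
  (P : forall p n : nat, probability (T p n) R)
  (X Y : forall p n : nat, T p n -> 'M[R]_(p, n))
  (hX : forall p n : nat, (0 < p)%N -> (0 < n)%N -> random_matrix (X p n))
  (hY : forall p n : nat, (0 < p)%N -> (0 < n)%N -> random_matrix (Y p n))
  (hXY : exists C c : R, [/\ 0 < C, 0 < c &
     forall p n : nat, (0 < p)%N -> (0 < n)%N ->
       lipschitz_conc_E2 (P p n) (X p n) (Y p n) C c])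
  (hEX : exists2 K : R, 0 < K &
     forall p n : nat, (0 < p)%N -> (0 < n)%N ->
       frobenius_norm (mx_expectation (P p n) (X p n)) <= K)
  (hEY : exists2 K : R, 0 < K &
     forall p n : nat, (0 < p)%N -> (0 < n)%N ->
       frobenius_norm (mx_expectation (P p n) (Y p n)) <= K) :
  exists C c : R, [/\ 0 < C, 0 < c &
    forall p n : nat, (0 < p)%N -> (0 < n)%N -> forall A : 'M[R]_p,
      linear_conc (P p n) (@frobenius_norm R n n)
        (fun w => (Y p n w)^T *m A *m X p n w)
        [:: (2, frobenius_norm A); (1, spectral_norm A)] C c].
Proof.
have [C [c [C0 c0 conc]]] := hXY.
have [KX KX0 EX] := hEX; have [KY KY0 EY] := hEY.
(* The given [C] is only positive, and the lemmas ask for a constant at least 1; [KX + KY] bounds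
   both means at once. *)
have C1 : 1 <= C + 1 by rewrite lerDr ltW.
have sc0 : 0 < scale_const (C + 1) c (KX + KY).
  rewrite /scale_const ltr_wpDl ?mulr_gt0 ?exprn_gt0// mulr_ge0 ?(ltW c0)//.
    by rewrite mulr_ge0 ?(ltW c0).
  rewrite addr_ge0 ?addr_ge0 ?(ltW KX0) ?(ltW KY0)// divr_ge0//.
  by rewrite addr_ge0// mulr_ge0 ?sqr_ge0// ltW// ltr_wpDl// ltW.
exists (deviation_const (C + 1) c (KX + KY)).
exists (2 * scale_const (C + 1) c (KX + KY)); split.
- by rewrite ltr_wpDl ?expR_gt0// mulr_ge0// (le_trans ler01).
- by rewrite mulr_gt0.
move=> p n p0 n0 A; apply: bilinear_form_linear_conc => //.
- by apply: lipschitz_conc_E2_weaken (conc p n p0 n0); rewrite lerDl.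
- exact: hX.
- exact: hY.
- by rewrite (le_trans (EX _ _ _ _))// lerDl ltW.
- by rewrite (le_trans (EY _ _ _ _))// lerDr ltW.
Qed.
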